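(* Let $P_{\text{ess}} \subset [0,1]$ be the essential fractal prime set. Then $$\dim_H(P_{\text{ess}}) = \frac{\log 2}{\log 4} = \frac{1}{2},$$ where $\dim_H$ denotes Hausdorff dimension.
   Context: The essential fractal prime set $P_{\text{ess}}$ is defined recursively. Put $I_0 = [0,1]$. For $n \ge 1$, given $I_{n-1}$ as a union of $2^{n-1}$ disjoint closed intervals of length $4^{-(n-1)}$, divide each of these intervals into four equal closed subintervals of length $4^{-n}$, labeled $0,1,2,3$ from left to right, and retain only the subintervals labeled $1$ and $3$. Let $I_n$ be the union of the retained subintervals at stage $n$. Define $P_{\text{ess}} = \bigcap_{n=1}^\infty I_n$. *)

(* Defs.v *)
From mathcomp Require Import all_boot all_order all_algebra.
From mathcomp Require Import all_classical all_reals all_analysis.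

Set Implicit Arguments.
Unset Strict Implicit.
Unset Printing Implicit Defensive.

Import Order.TTheory GRing.Theory Num.Theory.
Import numFieldNormedType.Exports.

Local Open Scope classical_set_scope.
Local Open Scope ring_scope.

Section hausdorff_dimension.
Context {R : realType} {T : metricType R}.
Local Open Scope ereal_scope.

(* The maximum with 0 makes the diameter of the empty set 0 instead of -oo. *)
Definition diam (A : set T) : \bar R :=
  maxe 0 (ereal_sup [set z | exists x y, [/\ A x, A y & z = (mdist x y)%:E]]).

(* For s = 0 the library convention is 0 `^ 0 = 1, so the empty set, which must
   contribute nothing to a cover, is treated separately. *)
Definition diam_power (s : R) (A : set T) : \bar R :=
  if A == set0 then 0 else poweR (diam A) s.

(* Finite covers are included, since the U k may be empty. *)
Definition delta_cover (delta : R) (A : set T) : set ((set T)^nat) :=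
  [set U | A `<=` \bigcup_k U k /\ forall k, diam (U k) <= delta%:E].

Definition hausdorff_premeasure (s delta : R) (A : set T) : \bar R :=
  ereal_inf [set \sum_(0 <= k <oo) diam_power s (U k)
            | U in delta_cover delta A].

(* The premeasure is nonincreasing in delta, so the supremum is its limit as
   delta tends to 0 from the right. *)
Definition hausdorff_measure (s : R) (A : set T) : \bar R :=
  ereal_sup [set hausdorff_premeasure s delta A
            | delta in [set delta : R | (0 < delta)%R]].

Definition hausdorff_dim (A : set T) : \bar R :=
  ereal_inf [set s%:E
            | s in [set s : R | (0 <= s)%R /\ hausdorff_measure s A = 0]].

End hausdorff_dimension.

Section essential_fractal_prime_set.
Context (R : realType).

(* The left endpoint of the closed subinterval labeled j (from 0 to 3) when
   [a, a + 4^-(n-1)] is divided into four subintervals of length 4^-n. *)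
Definition sub_left (n : nat) (a : R) (j : nat) : R := a + j%:R * 4 ^- n.

(* The left endpoints of the 2^n intervals of length 4^-n retained at
   stage n. *)
Fixpoint retained (n : nat) : seq R :=
  if n is m.+1 then
    flatten [seq [:: sub_left n a 1; sub_left n a 3] | a <- retained m]
  else [:: 0].

Definition I_stage (n : nat) : set R :=
  \bigcup_(a in [set` retained n]) [set` `[a, a + 4 ^- n]].

(* The metric structure of the real line is carried by R^o. *)
Definition P_ess : set R^o := \bigcap_(n in [set n | (1 <= n)%N]) I_stage n.

End essential_fractal_prime_set.

Arguments I_stage R n : clear implicits.
Arguments P_ess R : clear implicits.

(* Main.v *)
Require Import Defs.
From mathcomp Require Import all_boot all_order all_algebra.
From mathcomp Require Import all_classical all_reals all_analysis.
From mathcomp Require Import lra.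

(** Why the dimension is 1/2.

    Above 1/2: the [2 ^ n] intervals of stage [n] cover the set, and the sum of
    the [s]-th powers of their lengths [4 ^- n] is the [n]-th power of
    [2 / 4 `^ s], a ratio smaller than 1 as soon as [1/2 < s]. Letting [n] grow
    kills the [s]-dimensional measure ([hausdorff_measure_P_ess_eq0]).

    Up to 1/2: reading the binary digits of a number [t] of [0, 1[ as choices
    between the labels 1 and 3 gives a point [point_of t] of the set. If [t] and
    [u] differ by at least [2 ^- n], their [n]-digit prefixes differ, so their
    images lie over different intervals of stage [n], which are [4 ^- n] apart.
    Hence [(u - t) ^+ 2 <= 4 * |point_of u - point_of t|]: the inverse of
    [point_of] is 1/2-Hoelder. The preimages of the members of a cover of
    the set therefore cover the unit interval, while each is contained in an
    interval of length at most 4 times the square root of the diameter of that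
    member, and countable subadditivity of the Lebesgue measure bounds the sum
    of these square roots below by 1/4 ([hausdorff_measure_ge]). A smaller
    exponent only increases the powers of diameters at most 1, so no [s <= 1/2]
    has vanishing measure ([hausdorff_measure_P_ess_gt0]). *)

Import Order.TTheory GRing.Theory Num.Theory.
Import numFieldNormedType.Exports.

Local Open Scope classical_set_scope.
Local Open Scope ring_scope.

(** * Bounding Hausdorff measures in a metric space *)

Section hausdorff_estimates.
Context {R : realType} {T : metricType R}.
Implicit Types (A : set T) (U : (set T)^nat).
Local Open Scope ereal_scope.

Lemma diam_ge0 A : 0 <= diam A.
Proof. by rewrite /diam le_max lexx. Qed.

Lemma mdist_le_diam A x y : A x -> A y -> (mdist x y)%:E <= diam A.
Proof.
move=> Ax Ay; rewrite /diam le_max; apply/orP; right.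
by apply: ereal_sup_ubound; exists x, y.
Qed.

Lemma diam_le A (d : R) : (0 <= d)%R ->
  (forall x y, A x -> A y -> mdist x y <= d)%R -> diam A <= d%:E.
Proof.
move=> d0 Ad; rewrite /diam ge_max lee_fin d0/=.
by apply: ge_ereal_sup => _ [x [y [Ax Ay ->]]]; rewrite lee_fin Ad.
Qed.

Lemma diam_set0 : diam (set0 : set T) = 0.
Proof. by apply/eqP; rewrite eq_le diam_ge0 andbT; apply: diam_le. Qed.

Lemma diam_power_ge0 (s : R) A : 0 <= diam_power s A.
Proof. by rewrite /diam_power; case: ifPn => // _; exact: poweR_ge0. Qed.

Lemma diam_power_le (s d : R) A :
  (0 <= s)%R -> (0 <= d)%R -> diam A <= d%:E -> diam_power s A <= (d `^ s)%:E.
Proof.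
move=> s0 d0; rewrite /diam_power; case: ifPn => [_ _|_].
  by rewrite lee_fin powR_ge0.
have := diam_ge0 A; case: (diam A) => [r| |]//=; rewrite !lee_fin => r0 rd.
by apply: ge0_ler_powR.
Qed.

Lemma hausdorff_measure_ge0 (s : R) A : 0 <= hausdorff_measure s A.
Proof.
apply: (@le_trans _ _ (hausdorff_premeasure s 1 A)).
  apply: le_ereal_inf_tmp => _ [U _ <-].
  by apply: nneseries_ge0 => *; exact: diam_power_ge0.
by apply: ereal_sup_ubound; exists 1%R => //=.
Qed.

Lemma hausdorff_premeasure_le (s delta d : R) (N : nat) A U :
    (0 <= s)%R -> (0 <= d <= delta)%R ->
    A `<=` \bigcup_(k in `I_N) U k ->
    (forall k, (k < N)%N -> diam (U k) <= d%:E) ->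
  hausdorff_premeasure s delta A <= (N%:R * d `^ s)%:E.
Proof.
move=> s0 /andP[d0 ddelta] AU Ud.
(* Empty sets complete the finite cover to a sequence at no cost. *)
pose V k := if (k < N)%N then U k else set0.
have Vd k : diam (V k) <= d%:E.
  by rewrite /V; case: ifPn => [/Ud//|_]; rewrite diam_set0 lee_fin.
apply: (@le_trans _ _ (\sum_(0 <= k <oo) diam_power s (V k))).
  apply: ereal_inf_lbound; exists V => //; split.
    by move=> x /AU[k/= kN Ukx]; exists k; rewrite // /V kN.
  by move=> k; rewrite (le_trans (Vd k))// lee_fin.
rewrite (nneseries_split _ N); last by move=> *; exact: diam_power_ge0.
rewrite [X in _ + X]eseries0 ?adde0; last first.
  by move=> k; rewrite add0n leqNgt /V => /negbTE-> _; rewrite /diam_power eqxx.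
apply: (@le_trans _ _ (\sum_(0 <= k < 0 + N) (d `^ s)%:E)).
  by apply: lee_sum => k _; exact: diam_power_le.
by rewrite sumEFin lee_fin sumr_const_nat add0n subn0 mulr_natl.
Qed.

(** A map on the unit interval that does not shrink distances too much, in the
    sense that its inverse is [r]-Hoelder with constant [C], transports the
    Lebesgue measure of the interval to a lower bound on covers of its image:
    the preimage of a set of diameter [d] fits in an interval of length
    [2 * C * d `^ r], and these intervals cover the unit interval. *)
Lemma hausdorff_measure_ge (g : R -> T) (C r s : R) A :
    (0 <= s <= r)%R -> (0 < r)%R -> (0 < C)%R ->
    (forall t, 0 <= t < 1 -> A (g t))%R ->
    (forall t u, 0 <= t < 1 -> 0 <= u < 1 ->
      `|t - u| <= C * mdist (g t) (g u) `^ r)%R ->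
  ((2 * C)^-1)%:E <= hausdorff_measure s A.
Proof.
move=> /andP[s0 sr] r0 C0 gA gC.
apply: (@le_trans _ _ (hausdorff_premeasure s 1 A)); last first.
  by apply: ereal_sup_ubound; exists 1%R => //=.
apply: le_ereal_inf_tmp => _ [U [AU U1] <-].
rewrite -(@lee_pmul2l _ (2 * C)%:E) ?lte_fin ?mulr_gt0//.
rewrite -EFinM mulfV ?gt_eqF ?mulr_gt0//.
rewrite -nneseriesZl; last by move=> *; exact: diam_power_ge0.
(* Around any one parameter sent into [U k], an interval of radius [rad k]
   contains all the others. *)
pose J k t := (0 <= t < 1)%R /\ U k (g t).
pose rad k := (C * fine (diam (U k)) `^ r)%R.
pose V k : set R := if pselect (J k !=set0) is left e
  then [set` `[projT1 (cid e) - rad k, projT1 (cid e) + rad k]%R] else set0.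
have rad0 k : (0 <= rad k)%R by rewrite mulr_ge0 ?powR_ge0// ltW.
have fdiam k : diam (U k) = (fine (diam (U k)))%:E.
  by rewrite fineK// ge0_fin_numE ?diam_ge0// (le_lt_trans (U1 k)) ?ltry.
have VJ k t : J k t -> V k t.
  rewrite /V; case: pselect => [e Jt|]; last by move=> n Jt; case: n; exists t.
  case: (cid e) => u [u01 Uu]/=; rewrite in_itv/= -ler_distlC distrC.
  case: Jt => t01 Ut; rewrite (le_trans (gC _ _ t01 u01))// ler_pM2l//.
  apply: ge0_ler_powR; [exact: ltW|exact: mdist_ge0|exact: fine_ge0 (diam_ge0 _)|].
  by rewrite -lee_fin -fdiam; exact: mdist_le_diam.
have V01 : ([set` `[0%R, 1%R[] : set R) `<=` \bigcup_k V k.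
  move=> t /=; rewrite in_itv/= => t01.
  by have [k _ Ugt] := AU _ (gA _ t01); exists k => //; exact: VJ.
have mV k : measurable (V k).
  by rewrite /V; case: pselect => [e|_]; [exact: measurable_itv|exact: measurable0].
have := measure_sigma_subadditive (@lebesgue_measure R) mV (measurable_itv _) V01.
rewrite [X in X <= _]lebesgue_measure_itv/= lte_fin ltr01 oppr0 adde0 => /le_trans; apply.
apply: lee_nneseries => [k _ _|k _]; first exact: measure_ge0.
rewrite /V; case: pselect => [e|_]; last first.
  by rewrite measure0 mule_ge0 ?diam_power_ge0// lee_fin mulr_ge0// ltW.
rewrite lebesgue_measure_itv/= lte_fin; case: ifPn => _; last first.
  by rewrite mule_ge0 ?diam_power_ge0// lee_fin mulr_ge0// ltW.
have -> : (projT1 (cid e) + rad k)%:E - (projT1 (cid e) - rad k)%:E =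
    (2 * C)%:E * (fine (diam (U k)) `^ r)%:E.
  by rewrite -EFinB -EFinM; congr EFin; rewrite /rad; lra.
apply: lee_wpmul2l; first by rewrite lee_fin mulr_ge0// ltW.
have U0 : U k != set0.
  by case: e => t [_ Ut]; apply/set0P; exists (g t).
(* Lowering the exponent from [r] to [s] increases the power, as the diameter is
   at most 1; a null diameter is apart, since [0 `^ 0 = 1] but [0 `^ r = 0]. *)
rewrite /diam_power (negbTE U0) {2}fdiam poweR_EFin lee_fin.
have : (0 <= fine (diam (U k)) <= 1)%R.
  by rewrite fine_ge0 ?diam_ge0//= -lee_fin -fdiam.
case/andP; rewrite le_eqVlt => /predU1P[<- _|d0 d1].
  by rewrite powR0 ?gt_eqF// powR_ge0.
by apply: ger_powR => //; rewrite d0.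
Qed.

End hausdorff_estimates.

(** * The intervals of each stage *)

Section essential_fractal_prime_set.
Context {R : realType}.

(** For [k < 2 ^ n], the left endpoint of the [k]-th interval of stage [n],
    counted from [0] on the left: the binary digits [0] and [1] of [k] select the labels [1] and
    [3]. *)
Fixpoint code (n k : nat) : R :=
  if n is m.+1 then sub_left n (code m k./2) (if odd k then 3 else 1) else 0.

Lemma exprVS4 n : 4 ^- n.+1 = 4 ^- n / 4 :> R.
Proof. by rewrite exprS invfM mulrC. Qed.

Lemma exprV4_gt0 n : 0 < 4 ^- n :> R.
Proof. by rewrite invr_gt0 exprn_gt0. Qed.

Lemma size_retained n : size (retained R n) = (2 ^ n)%N.
Proof.
elim: n => //= n IHn; rewrite size_flatten expnS -IHn.
by elim: (retained R n) => //= _ r; rewrite /shape/= => ->; rewrite mulnS.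
Qed.

Lemma code_retained n k : code n k \in retained R n.
Proof.
elim: n k => [|n IHn] k; first by rewrite inE.
apply/flattenP.
exists [:: sub_left n.+1 (code n k./2) 1; sub_left n.+1 (code n k./2) 3].
  by apply/mapP; exists (code n k./2).
by rewrite /= !inE; case: (odd k); rewrite eqxx ?orbT.
Qed.

(** The interval of index [k] lies inside its parent, which has index [k./2]. *)
Lemma code_sub n k : code n k./2 <= code n.+1 k /\
  code n.+1 k + 4 ^- n.+1 <= code n k./2 + 4 ^- n.
Proof.
rewrite [code n.+1 k]/= /sub_left exprVS4; have := exprV4_gt0 n.
by case: (odd k) => /= e0; split; lra.
Qed.

(** Retained intervals of one stage are separated by at least their length: the
    gap is created between labels [1] and [3] of the last common ancestor, and
    the outer quarters removed afterwards can only widen it. *)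
Lemma code_sep n k l : (k < l < 2 ^ n)%N -> code n k + 2 * 4 ^- n <= code n l.
Proof.
elim: n k l => [|n IHn] k l /andP[kl ln]; first by case: l kl ln => [|[]].
rewrite [code n.+1 k]/= [code n.+1 l]/= /sub_left exprVS4.
have e0 := exprV4_gt0 n.
have [lt2|ge2] := ltnP k./2 l./2.
  have /IHn : (k./2 < l./2 < 2 ^ n)%N.
    by rewrite lt2/= ltn_half_double -mul2n -expnS.
  by case: (odd k) (odd l) => [] []/=; lra.
have kl2 : k./2 = l./2 by apply/eqP; rewrite eqn_leq ge2 half_leq// ltnW.
have [-> ->] : odd k = false /\ odd l = true.
  move: kl; rewrite -[k]odd_double_half -[l]odd_double_half kl2 ltn_add2r.
  by rewrite !oddD !odd_double !addbF !oddb; case: (odd k) (odd l) => [] [].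
by rewrite kl2 /=; lra.
Qed.

(** * The point with given binary digits *)

(** For [0 <= t < 1], the integer written by the first [n] binary digits of
    [t]. *)
Definition digits (n : nat) (t : R) : nat := Num.truncn (2 ^+ n * t).

Lemma half_digits n t : 0 <= t -> (digits n.+1 t)./2 = digits n t.
Proof.
move=> t0; have t0' m : 0 <= 2 ^+ m * t by rewrite mulr_ge0// exprn_ge0.
apply/esym/truncn_def; have /andP[] := truncn_itv (t0' n.+1).
rewrite -/(digits n.+1 t) exprS -mulrA.
rewrite -[X in X%:R <= _]odd_double_half -[X in _ < X.+1%:R]odd_double_half.
rewrite -addnS -[(_.*2).+1]addn1 !natrD -mul2n natrM -natr1.
by case: odd => /=; lra.
Qed.

Definition left_end (t : R) (n : nat) : R := code n (digits n t).

(** For [0 <= t], the common point of the nested intervals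
    [[left_end t n, left_end t n + 4 ^- n]]. *)
Definition point_of (t : R) : R := sup (range (left_end t)).

Lemma left_end_le_right_end t m n : 0 <= t ->
  left_end t m <= left_end t n + 4 ^- n.
Proof.
move=> t0.
have /nondecreasing_seqP al : forall i, left_end t i <= left_end t i.+1.
  by move=> i; have [] := code_sub i (digits i.+1 t); rewrite half_digits.
have bl : {homo (fun i => left_end t i + 4 ^- i) : i j / (i <= j)%N >-> j <= i}.
  apply/nonincreasing_seqP => i.
  by have [] := code_sub i (digits i.+1 t); rewrite half_digits.
rewrite (le_trans (al _ _ (leq_maxl m n)))// (le_trans _ (bl _ _ (leq_maxr m n)))//.
by rewrite lerDl ltW// exprV4_gt0.
Qed.

Lemma point_of_itv t n : 0 <= t ->
  left_end t n <= point_of t <= left_end t n + 4 ^- n.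
Proof.
move=> t0; apply/andP; split.
  apply: ub_le_sup; last by exists n.
  by exists (left_end t n + 4 ^- n) => _ [m _ <-]; exact: left_end_le_right_end.
apply: ge_sup; first by exists (left_end t 0), 0%N.
by move=> _ [m _ <-]; exact: left_end_le_right_end.
Qed.

Lemma point_of_P_ess t : 0 <= t -> P_ess R (point_of t).
Proof.
move=> t0 n _; exists (left_end t n); first exact: code_retained.
by rewrite /= in_itv/= point_of_itv.
Qed.

(** Points at distance at least [2 ^- n] have different [n]-digit prefixes,
    hence lie over separated intervals of stage [n]. *)
Lemma point_of_sep n t u : 0 <= t -> u < 1 -> t + 2 ^- n <= u ->
  4 ^- n <= point_of u - point_of t.
Proof.
move=> t0 u1 tu.
have p0 : 0 < 2 ^+ n :> R by rewrite exprn_gt0.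
have u0 : 0 <= u by rewrite (le_trans _ tu)// addr_ge0// ltW// invr_gt0.
have ntu : 2 ^+ n * t + 1 <= 2 ^+ n * u.
  by move: tu; rewrite -(ler_pM2l p0) mulrDr mulfV// gt_eqF.
have /code_sep : (digits n t < digits n u < 2 ^ n)%N.
  rewrite /digits truncn_ge_nat ?mulr_ge0 ?(ltW p0)//; apply/andP; split.
    rewrite -natr1 (le_trans _ ntu)// lerD2r truncn_le.
    by rewrite mulr_ge0 ?(ltW p0).
  rewrite truncn_lt_nat ?mulr_ge0 ?(ltW p0)// natrX.
  by rewrite -[ltRHS]mulr1 ltr_pM2l.
have /andP[_] := point_of_itv t n t0; have /andP[+ _] := point_of_itv u n u0.
by rewrite /left_end; lra.
Qed.

Lemma point_of_expand t u : 0 <= t -> t < u -> u < 1 ->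
  (u - t) ^+ 2 <= 4 * (point_of u - point_of t).
Proof.
move=> t0 tu u1; have d0 : 0 < u - t by rewrite subr_gt0.
have exn : exists n, 2 ^- n <= u - t.
  have /cvgr0_norm_lt/(_ _ d0)[n _ /(_ n (leqnn n))/=] :
      (2^-1 : R) ^+ m @[m --> \oo] --> 0 by apply: cvg_expr; rewrite gtr0_norm; lra.
  by rewrite exprVn => /(le_lt_trans (ler_norm _))/ltW; exists n.
(* By minimality [u - t] lies between [2 ^- n] and [2 * 2 ^- n], so that the
   separation at scale [n] loses a factor [2 ^+ 2] only. *)
case: (ex_minnP exn) => n nd nmin.
have d2 : u - t <= 2 * 2 ^- n.
  case: n nd nmin => [_ _|n nd nmin]; first by rewrite expr0; lra.
  rewrite exprS invfM mulrA mulfV// mul1r leNgt; apply/negP => /ltW/nmin.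
  by rewrite ltnn.
have sep : 4 ^- n <= point_of u - point_of t by apply: point_of_sep => //; lra.
apply: (@le_trans _ _ (4 * 4 ^- n)); last by rewrite ler_pM2l.
have -> : 4 * 4 ^- n = (2 * 2 ^- n) ^+ 2 :> R.
  by rewrite exprMn exprVn exprAC -[4]/((2 ^ 2)%:R) natrX.
by rewrite ler_sqr ?nnegrE// ?mulr_ge0 ?invr_ge0 ?exprn_ge0// ltW.
Qed.

Lemma point_of_inverse_holder t u : 0 <= t < 1 -> 0 <= u < 1 ->
  `|t - u| <= 2 * mdist (point_of t : R^o) (point_of u) `^ 2^-1.
Proof.
wlog tu : t u / t <= u => [H t01 u01|].
  by have [|/ltW] := leP t u => ?; [exact: H|rewrite distrC metric_sym; exact: H].
move=> /andP[t0 _] /andP[_ u1]; have [->|ntu] := eqVneq t u.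
  by rewrite subrr normr0 mulr_ge0// powR_ge0.
have {ntu}tu : t < u by rewrite lt_neqAle ntu.
have e := point_of_expand t u t0 tu u1.
have pp : 0 <= point_of u - point_of t.
  by have := le_trans (sqr_ge0 _) e; rewrite pmulr_rge0.
rewrite /mdist/= (ger0_norm pp) powR12_sqrt// ltr0_norm ?subr_lt0// opprB.
rewrite -ler_sqr ?nnegrE ?mulr_ge0 ?sqrtr_ge0 ?subr_ge0 ?(ltW tu)//.
by rewrite exprMn sqr_sqrtr// -natrX.
Qed.

(** * Positive and vanishing Hausdorff measures *)

Lemma hausdorff_measure_P_ess_gt0 (s : R) : 0 <= s <= 2^-1 ->
  (0 < hausdorff_measure s (P_ess R))%E.
Proof.
move=> s12; apply: (@lt_le_trans _ _ ((2 * 2)^-1)%:E).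
  by rewrite lte_fin invr_gt0.
apply: (hausdorff_measure_ge (point_of : R -> R^o) 2 2^-1) => //.
- by move=> t /andP[t0 _]; exact: point_of_P_ess.
- exact: point_of_inverse_holder.
Qed.

Lemma diam_itv (a d : R) : 0 <= d ->
  (diam ([set` `[a, a + d]%R] : set R^o) <= d%:E)%E.
Proof.
move=> d0; apply: diam_le => // x y /=; rewrite !in_itv/= => ax ay.
by rewrite /mdist/= ler_norml; lra.
Qed.

Lemma hausdorff_measure_P_ess_eq0 (s : R) : 2^-1 < s ->
  hausdorff_measure s (P_ess R) = 0%E.
Proof.
move=> s12; have s0 : 0 <= s by lra.
apply/eqP; rewrite eq_le hausdorff_measure_ge0 andbT.
apply: ge_ereal_sup => _ [delta /= delta0 <-].
apply/lee_addgt0Pr => e e0; rewrite add0e.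
pose q : R := 2 * 4^-1 `^ s.
have q1 : `|q| < 1.
  rewrite ger0_norm ?mulr_ge0 ?powR_ge0//.
  (* [q < 1] amounts to [2 = 4 `^ (1/2) < 4 `^ s]. *)
  have -> : q = 2 / 4 `^ s by rewrite /q -powR_inv1// powRAC powR_inv1 ?powR_ge0.
  rewrite ltr_pdivrMr ?powR_gt0// mul1r.
  have -> : 2 = 4 `^ 2^-1 :> R.
    by rewrite powR12_sqrt// (_ : 4 = 2 ^+ 2) ?sqrtr_sqr ?ger0_norm// -natrX.
  by rewrite /powR pnatr_eq0/= ltr_expR ltr_pM2r// ln_gt0// ltr1n.
have q41 : `|4^-1 : R| < 1 by rewrite gtr0_norm; lra.
near \oo => n.
apply: (@le_trans _ _ ((2 ^ n)%:R * (4 ^- n) `^ s)%:E).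
  apply: (hausdorff_premeasure_le _ _ _ _ _
    (fun k => [set` `[(retained R n)`_k, (retained R n)`_k + 4 ^- n]] : set R^o)) => //.
  - rewrite ltW ?exprV4_gt0//= -exprVn -[leLHS]ger0_norm ?exprn_ge0//.
    by near: n; apply: cvgr0_norm_le => //; exact: cvg_expr.
  - move=> x /(_ n); case; first by near: n; exact: nbhs_infty_ge.
    move=> a /= ar xa; exists (index a (retained R n)) => /=.
      by rewrite -size_retained index_mem.
    by rewrite nth_index.
  - by move=> k _; apply: diam_itv; rewrite ltW// exprV4_gt0.
rewrite lee_fin (_ : _ * _ = q ^+ n).
  rewrite (le_trans (ler_norm _))//.
  by near: n; apply: cvgr0_norm_le => //; exact: cvg_expr.
rewrite /q exprMn natrX; congr (_ * _).
by rewrite -exprVn -!powR_mulrn ?powR_ge0// powRAC.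
Unshelve. all: by end_near. Qed.

End essential_fractal_prime_set.

Theorem theorem3p4 (R : realType) :
  hausdorff_dim (P_ess R) = (ln 2 / ln 4)%:E /\ ln 2 / ln 4 = 1 / 2 :> R.
Proof.
have ln2 : 0 < ln 2 :> R by rewrite ln_gt0// ltr1n.
have ratio : ln 2 / ln 4 = 1 / 2 :> R.
  rewrite (_ : 4 = 2 ^+ 2) ?lnXn//; last by rewrite -natrX.
  by rewrite -[ln 2 *+ 2]mulr_natl invfM mulrCA divff ?gt_eqF// mulr1 div1r.
split=> //; rewrite ratio div1r; apply/eqP; rewrite eq_le; apply/andP; split.
  apply/lee_addgt0Pr => e e0; apply: ereal_inf_lbound; exists (2^-1 + e) => //.
  split; first by lra.
  by apply: hausdorff_measure_P_ess_eq0; lra.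
apply: le_ereal_inf_tmp => _ [s [s0 Hs] <-]; rewrite lee_fin leNgt.
apply/negP => /ltW s12; have := @hausdorff_measure_P_ess_gt0 R s.
by rewrite s0 s12 Hs ltxx => /(_ isT).
Qed.
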